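(* Let $n\ge1$, let $F(x,y_0,\ldots,y_n)\not\equiv0$ be holomorphic in a neighbourhood of $0\in\mathbb{C}^{n+2}$ with $F(0)=0$, and let $\varphi=\sum_{k=1}^{\infty}c_k(t)x^{\lambda_k}$ ($t=\ln x$, $c_k\in\mathbb{C}[t]$, $c_1\not\equiv0$, $\lambda_k\in\mathbb{C}$, $0<\mathrm{Re}\,\lambda_1\le\mathrm{Re}\,\lambda_2\le\ldots\to\infty$) be a Dulac series which is a formal solution of $F(x,y,\delta y,\ldots,\delta^ny)=0$, $\delta=x\,d/dx$. Assume $F'_{y_n}(x,\varphi,\ldots,\delta^n\varphi)\not\equiv0$ and that for each $j=0,\ldots,n$, $$F'_{y_j}(x,\varphi,\ldots,\delta^n\varphi)=A_j\,x^{\nu}+B_j(t)\,x^{\nu_j}+\ldots,\qquad A_j\in\mathbb{C},\ B_j\in\mathbb{C}[t]\setminus\{0\},\ \mathrm{Re}\,\nu_j>\mathrm{Re}\,\nu,$$ where the dots denote terms $b(t)x^\sigma$ with $\mathrm{Re}\,\sigma\ge\mathrm{Re}\,\nu_j$, $\nu\in\mathbb{C}$ is the same for all $j$, and at least one $A_j\neq0$. Then there exist $\kappa\in\mathbb{N}$ and complex numbers $r_1,\ldots,r_\kappa$, linearly independent over $\mathbb{Z}$ and with $\mathrm{Re}\,r_i>0$, such that, with $$\mathrm{G}=\Bigl\{\sum_{i=1}^{\kappa}m_ir_i\ \Big|\ \mathbf{m}\in\mathbb{Z}_+^{\kappa}\setminus\{0\}\Bigr\},$$ one has $1\in\mathrm{G}$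 and $\lambda_k\in\mathrm{G}$ for all $k$, i.e. $\varphi\in\mathbb{C}[t][[x^{\mathrm{G}}]]$.
   Context: Dulac series, the action of $\delta$ on them ($\delta\sum c_k(t)x^{\lambda_k}=\sum(\lambda_k+d/dt)c_k(t)x^{\lambda_k}$), substitution into holomorphic $F$ via its Taylor series, and formal solutions (substitution yields the zero series) are as usual. $\mathbb{C}[t][[x^{\mathrm{G}}]]$ denotes the ring of formal Dulac series all of whose exponents lie in $\mathrm{G}$; note $0\notin\mathrm{G}$. *)

(* Defs.v *)
From HB Require Import structures.
From mathcomp Require Import all_boot all_order all_algebra.
From mathcomp Require Import boolp classical_sets functions cardinality fsbigop reals.
From mathcomp Require Import complex.

Set Implicit Arguments.
Unset Strict Implicit.
Unset Printing Implicit Defensive.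

Import Order.TTheory GRing.Theory Num.Theory.
Local Open Scope ring_scope.
Local Open Scope classical_set_scope.
Local Open Scope complex_scope.

(* A formal "Dulac-type" series  sum_lambda a(lambda)(t) x^lambda  (t = ln x)
   is represented by its coefficient map  a : C -> C[t]. *)
Definition dseries (R : realType) := R[i] -> {poly R[i]}.

Section Series.
Variable R : realType.
Local Notation C := R[i].
Local Notation S := (dseries R).

Definition dsupp (a : S) : set C := [set l | a l != 0].

(* well-formedness of a formal series: below every real level only finitely
   many exponents occur (so the exponents can be listed with Re -> oo) *)
Definition dwf (a : S) : Prop :=
  forall M : R, finite_set [set l | a l != 0 /\ complex.Re l <= M].

Definition dulac (a : S) : Prop :=
  [/\ dwf a, exists l, a l != 0 & forall l, a l != 0 -> 0 < complex.Re l].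

Definition dzero : S := fun _ => 0.
Definition done : S := fun l => if l == 0 then 1 else 0.
Definition dX : S := fun l => if l == 1 then 1 else 0.

(* delta = x d/dx :  delta (c(t) x^l) = (l c(t) + c'(t)) x^l *)
Definition ddelta (a : S) : S := fun l => l *: a l + (a l)^`().

(* product of two series (finite sums for well-formed series with
   real parts of exponents bounded below) *)
Definition dmul (a b : S) : S :=
  fun m => \sum_(l \in [set: C]) (a l * b (m - l)).

Definition dexp (a : S) (k : nat) : S := iter k (dmul a) done.

Definition dmono (m : nat) (s : 'I_m -> S) (al : {ffun 'I_m -> nat}) : S :=
  foldr dmul done [seq dexp (s i) (al i) | i <- enum 'I_m].

Definition dsubst (m : nat) (Fc : {ffun 'I_m -> nat} -> C) (s : 'I_m -> S) : S :=
  fun mu => \sum_(al \in [set: {ffun 'I_m -> nat}]) (Fc al *: dmono s al mu).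

Definition mdeg (m : nat) (al : {ffun 'I_m -> nat}) : nat := \sum_i al i.

(* the Taylor series converges in a neighbourhood of 0, i.e. F is holomorphic
   near 0 (Cauchy estimates on a polydisc of radius rho) *)
Definition conv_pseries (m : nat) (Fc : {ffun 'I_m -> nat} -> C) : Prop :=
  exists rho K : R, 0 < rho /\
    forall al, `|Fc al| <= (K / rho ^+ mdeg al)%:C.

Definition pderiv_coef (m : nat) (Fc : {ffun 'I_m -> nat} -> C) (j : 'I_m) :
  {ffun 'I_m -> nat} -> C :=
  fun al => (al j).+1%:R * Fc [ffun i => al i + (i == j)%N].

Definition dargs (n : nat) (phi : S) : 'I_n.+2 -> S :=
  fun i => match unlift ord0 i with
           | None => dX
           | Some j => iter j (ddelta) phi
           end.

End Series.

Definition gen_semigroup (R : realType) (kappa : nat) (r : 'I_kappa -> R[i]) : set R[i] :=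
  [set z | exists m : 'I_kappa -> nat,
      (exists i, m i != 0%N) /\ z = \sum_(i < kappa) (m i)%:R * r i].

Definition Zlin_indep (R : realType) (kappa : nat) (r : 'I_kappa -> R[i]) : Prop :=
  forall m : 'I_kappa -> int,
    \sum_(i < kappa) (m i)%:~R * r i = 0 -> forall i, m i = 0.
Arguments dargs {R} n phi _.

(* Main.v *)
(* Above a level [M], argue by induction on [Re l]: split [phi] into the terms
   of real part [< L = Re l] and the rest.  Expanding [F] to first order around
   [phi], quadratic terms have real part at least [2 L > Re (nu + l)], so the
   coefficient of [x ^ (nu + l)] is that of [F] at the head of [phi] plus
   [\sum_j A_j (l + d/dt) ^ j] applied to the coefficient of [x ^ l].  For large
   [Re l] the latter is nonzero, hence [nu + l] is a sum of [1] and of exponents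
   of the head.  Writing large exponents as [nu + mu], this puts [mu] in the
   monoid generated by the small exponents [V] and by finitely many elements of
   positive real part of [span V - nu] and [span V - 2 nu].  Finally, a finitely
   generated monoid in [{Re > 0}] embeds in a free one with generators in
   [{Re > 0}]. *)
Require Import Defs.
From HB Require Import structures.
From mathcomp Require Import all_boot all_order all_algebra.
From mathcomp Require Import boolp classical_sets functions cardinality fsbigop reals.
From mathcomp Require Import complex.
From mathcomp Require Import ring.

Import Order.TTheory GRing.Theory Num.Theory.
Local Open Scope ring_scope.
Local Open Scope classical_set_scope.
Local Open Scope complex_scope.

(** * Real parts under addition and integer scaling *)

Section RealPart.
Variable R : realType.
Local Notation C := R[i].
Local Notation Re := (@complex.Re R).
Implicit Types z w : C.

Lemma ReD z w : Re (z + w) = Re z + Re w.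
Proof. by case: z w => [a b] [c d]. Qed.

Lemma ReN z : Re (- z) = - Re z.
Proof. by case: z. Qed.

Lemma ReB z w : Re (z - w) = Re z - Re w.
Proof. by rewrite ReD ReN. Qed.

Lemma Re_sum (I : Type) (s : seq I) (P : pred I) (f : I -> C) :
  Re (\sum_(i <- s | P i) f i) = \sum_(i <- s | P i) Re (f i).
Proof. by apply: (big_morph Re ReD). Qed.

Lemma Re_Ml (a : R) z : Re (a%:C * z) = a * Re z.
Proof. by case: z => c d /=; rewrite mul0r subr0. Qed.

Lemma natC (k : nat) : k%:R = (k%:R : R)%:C :> C.
Proof. by rewrite rmorph_nat. Qed.

Lemma intC (k : int) : k%:~R = (k%:~R : R)%:C :> C.
Proof. by rewrite rmorph_int. Qed.

Lemma Re_natM (k : nat) z : Re (k%:R * z) = k%:R * Re z.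
Proof. by rewrite natC Re_Ml. Qed.

Lemma Re_intM (k : int) z : Re (k%:~R * z) = k%:~R * Re z.
Proof. by rewrite intC Re_Ml. Qed.

End RealPart.

(** * Embedding a finitely generated monoid of positive real part in a free one *)

Section Cone.
Variable R : realType.
Local Notation C := R[i].
Local Notation Re := (@complex.Re R).

Definition ncomb (kappa : nat) (r : 'I_kappa -> C) (u : C) : Prop :=
  exists m : 'I_kappa -> nat, u = \sum_i (m i)%:R * r i.

Lemma ncomb0 (kappa : nat) (r : 'I_kappa -> C) : ncomb _ r 0.
Proof. by exists (fun=> 0%N); rewrite big1 // => i _; rewrite mul0r. Qed.

Lemma ncombD (kappa : nat) (r : 'I_kappa -> C) (u v : C) :
  ncomb _ r u -> ncomb _ r v -> ncomb _ r (u + v).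
Proof.
move=> [m ->] [m' ->]; exists (fun i => m i + m' i)%N.
by rewrite -big_split; apply: eq_bigr => i _; rewrite natrD mulrDl.
Qed.

Lemma ncomb_sum (kappa : nat) (r : 'I_kappa -> C) (I : Type) (s : seq I)
    (P : pred I) (f : I -> C) :
  (forall i, P i -> ncomb _ r (f i)) -> ncomb _ r (\sum_(i <- s | P i) f i).
Proof.
by move=> h; elim/big_rec: _ => [|i x Pi hx]; [exact: ncomb0 | exact/ncombD/hx/h].
Qed.

Lemma ncombM (kappa : nat) (r : 'I_kappa -> C) (k : nat) (u : C) :
  ncomb _ r u -> ncomb _ r (k%:R * u).
Proof.
move=> [m ->]; exists (fun i => k * m i)%N.
by rewrite mulr_sumr; apply: eq_bigr => i _; rewrite natrM mulrA.
Qed.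

Lemma ncomb_gen (kappa : nat) (r : 'I_kappa -> C) i : ncomb _ r (r i).
Proof.
exists (fun j => (j == i : nat)); rewrite (bigD1 i) //= eqxx mul1r big1 ?addr0 //.
by move=> j /negPf ->; rewrite mul0r.
Qed.

Lemma ncomb_trans (kappa kappa' : nat) (r : 'I_kappa -> C) (r' : 'I_kappa' -> C) u :
  (forall i, ncomb _ r' (r i)) -> ncomb _ r u -> ncomb _ r' u.
Proof. by move=> h [m ->]; apply: ncomb_sum => i _; apply: ncombM. Qed.

(* The weights [a i j / d] approximate [|m j| l i / Q] from above, where [Q] is
   the positive part of [\sum_i m i * l i]: moving them keeps all [l] positive
   and cancels every negative coefficient. *)
Lemma rounded_weights (kappa : nat) (l : 'I_kappa -> R) (m : 'I_kappa -> int) :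
  (forall i, 0 < l i) -> 0 < \sum_i (m i)%:~R * l i ->
  exists (d : nat) (a : 'I_kappa -> 'I_kappa -> nat),
  [/\ (0 < d)%N,
      forall i j, ~~ ((0 < m i) && (m j < 0)) -> a i j = 0%N,
      forall i, \sum_j (a i j)%:R * l j < d%:R * l i &
      forall j, 0 <= m j *+ d + \sum_i m i * (a i j)%:Z].
Proof.
move=> l0 hm.
pose Q := \sum_(i | 0 < m i) (m i)%:~R * l i.
pose N := \sum_(j | m j < 0) - (m j)%:~R * l j.
have QN : N < Q.
  rewrite -subr_gt0 /Q /N; apply: lt_le_trans hm _.
  rewrite (bigID (fun i => 0 < m i)) /= lerD2l -sumrN.
  rewrite (bigID (fun i => m i < 0)) /= [X in _ + X]big1 ?addr0.
    rewrite le_eqVlt; apply/orP; left; apply/eqP.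
    apply: eq_big => [i|i _]; last by rewrite mulNr opprK.
    by case: ltgtP.
  move=> i; rewrite -!leNgt => /andP[a b]; have -> : m i = 0 by apply/le_anti/andP.
  by rewrite mul0r.
have N0 : 0 <= N.
  apply: sumr_ge0 => j mj; apply: mulr_ge0; last exact: ltW.
  by rewrite oppr_ge0 lerz0 ltW.
have Q0 : 0 < Q by apply: le_lt_trans QN.
pose S := \sum_j l j.
have S0 : 0 <= S by apply: sumr_ge0 => j _; apply/ltW.
(* Rounding up costs row [i] at most [S], and its slack is [d * l i * (Q - N) / Q]. As [B] dominates
   every required ratio, [d > B] leaves all rows positive. *)
pose B := \sum_i S * Q / (l i * (Q - N)).
have Bi i : S * Q / (l i * (Q - N)) <= B.
  rewrite /B (bigD1 i) //= lerDl; apply: sumr_ge0 => j _.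
  by rewrite divr_ge0 ?mulr_ge0 ?subr_ge0 // ltW.
pose d := (Num.truncn B).+1.
have Bd : B < d%:R.
  by apply: truncnS_gt.
have d0 : 0 < d%:R :> R by rewrite ltr0n.
pose x i j : R := d%:R * `|(m j)%:~R| * l i / Q.
have x0 i j : 0 <= x i j by rewrite /x divr_ge0 ?mulr_ge0 // ltW.
pose a i j : nat := if (0 < m i) && (m j < 0) then (Num.truncn (x i j)).+1 else 0%N.
exists d, a; split => //.
- by move=> i j; rewrite /a => /negPf ->.
- move=> i; have [mi|mi] := boolP (0 < m i); last first.
    rewrite big1 => [|j _]; first by rewrite mulr_gt0.
    by rewrite /a (negPf mi) mul0r.
  have : \sum_j (a i j)%:R * l j <= d%:R * l i * N / Q + S.
    rewrite /N /S mulr_sumr mulr_suml [X in _ <= X + _]big_mkcond -big_split /=.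
    apply: ler_sum => j _; rewrite /a mi /=; case: ifPn => mj; last by rewrite mul0r add0r ltW.
    rewrite -natr1 mulrDl mul1r lerD2r.
    have -> : d%:R * l i * (- (m j)%:~R * l j) / Q = x i j * l j.
      by rewrite /x ltr0_norm ?ltrz0 //; field; rewrite gt_eqF.
    by rewrite ler_pM2r // truncn_le.
  move=> h; apply: le_lt_trans h _.
  rewrite -ltrBrDl.
  have -> : d%:R * l i - d%:R * l i * N / Q = d%:R * (l i * (Q - N) / Q).
    by field; rewrite gt_eqF.
  rewrite -ltr_pdivrMr; last by rewrite divr_gt0 ?mulr_gt0 ?subr_gt0.
  apply: le_lt_trans Bd; apply: le_trans (Bi i).
  by rewrite invf_div mulrA.
- move=> j; have [mj|mj] := ltP (m j) 0; last first.
    rewrite addr_ge0 ?mulrn_wge0 // sumr_ge0 // => i _.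
    by rewrite /a [m j < 0]ltNge mj andbF mulr0.
  rewrite -(ler_int R) rmorphD rmorph_sum rmorphMn /= mulr0z.
  rewrite -lerBlDl sub0r.
  (* Before rounding the cancellation is exact, because the positive [m i] satisfy
     [\sum_i m i * l i = Q]; rounding up only increases the sum. *)
  have -> : - ((m j)%:~R *+ d) = \sum_(i | 0 < m i) (m i)%:~R * x i j.
    rewrite /x; under eq_bigr do rewrite !mulrA.
    rewrite -mulr_suml; apply: (mulIf (lt0r_neq0 Q0)); rewrite mulfVK ?gt_eqF //.
    rewrite ltr0_norm ?ltrz0 // /Q mulr_sumr; apply: eq_bigr => i _.
    by rewrite -mulr_natl; ring.
  rewrite [leRHS](bigID (fun i => 0 < m i)) /= [X in _ + X]big1 ?addr0; last first.
    by move=> i mi; rewrite /a (negPf mi) mulr0.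
  apply: ler_sum => i mi; rewrite /a mi mj rmorphM /=.
  by rewrite ler_pM2l ?ltr0z // ltW // truncnS_gt.
Qed.

(** If no nonzero integer multiple of [v] is an integer combination of the [r i], then [v] joins
    them as a new generator. Otherwise [k * v = \sum_i m i * r i] with [k > 0] after a sign change,
    and each [r i] is replaced by [(d * r i - \sum_j a i j * r j) / (k * d * d)], with the weights
    of [rounded_weights]. The coefficients of [v] become [m j * d + \sum_i m i * a i j], which are
    nonnegative. *)
Lemma cone_adjoin (kappa : nat) (r : 'I_kappa -> C) (v : C) :
  Zlin_indep r -> (forall i, 0 < Re (r i)) -> 0 < Re v ->
  exists (kappa' : nat) (r' : 'I_kappa' -> C),
  [/\ Zlin_indep r', forall i, 0 < Re (r' i),
      forall i, ncomb _ r' (r i) & ncomb _ r' v].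
Proof.
move=> rind r0 v0.
have [[k [m [k0 kv]]]|nodep] := pselect (exists (k : int) (m : 'I_kappa -> int),
    k != 0 /\ k%:~R * v = \sum_i (m i)%:~R * r i); last first.
  exists kappa.+1, (fun i => oapp r v (unlift ord0 i)); split.
  - move=> m; rewrite big_ord_recl unlift_none /=.
    under eq_bigr do rewrite liftK /=.
    move=> /eqP; rewrite addr_eq0 => /eqP hm.
    have m0 : m ord0 = 0.
      apply/eqP/negPn/negP => m0; apply: nodep.
      exists (m ord0), (fun i => - m (lift ord0 i)); split => //.
      by rewrite hm -sumrN; apply: eq_bigr => i _; rewrite rmorphN mulNr.
    move=> i; case: (unliftP ord0 i) => [j ->|-> //].
    have h0 : \sum_i (m (lift ord0 i))%:~R * r i = 0.
      by apply/eqP; rewrite -oppr_eq0 -hm m0 mul0r.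
    exact: (rind _ h0).
  - by move=> i; case: (unliftP ord0 i) => [j _|_] /=.
  - move=> i; have := ncomb_gen _ (fun i => oapp r v (unlift ord0 i)) (lift ord0 i).
    by rewrite liftK.
  - have := ncomb_gen _ (fun i : 'I_kappa.+1 => oapp r v (unlift ord0 i)) ord0.
    by rewrite unlift_none.
wlog k_gt0 : k m k0 kv / 0 < k.
  move=> h; case: (ltgtP k 0) k0 => [kn|kp|_] // _; last by apply: (h k m); rewrite // gt_eqF.
  apply: (h (- k) (fun i => - m i)); rewrite ?oppr_eq0 ?oppr_gt0 ?lt_eqF //.
  rewrite rmorphN mulNr kv -sumrN.
  by apply: eq_bigr => i _; rewrite rmorphN mulNr.
case: k k_gt0 kv {k0} => // k k_gt0 kv.
have hm : 0 < \sum_i (m i)%:~R * Re (r i).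
  under eq_bigr do rewrite -Re_intM.
  by rewrite -Re_sum -kv Re_intM mulr_gt0 // ltr0z.
have {}k_gt0 : (0 < k)%N by [].
have [d [a [d0 a0 al am]]] := rounded_weights _ _ m r0 hm.
have d_neq0 : d%:R != 0 :> C by rewrite pnatr_eq0 -lt0n.
(* As [a i j] is nonzero only for [m i > 0 > m j], the matrix [a] has square zero, so [d * d]
   suffices as denominator when expressing the [r i] through the [s i]; the factor [k] then allows
   for the division by [k] in [v]. *)
pose D : C := (k * d * d)%:R.
have D_neq0 : D != 0 by rewrite pnatr_eq0 !muln_eq0 !negb_or -!lt0n k_gt0 d0.
pose s i : C := d%:R * r i - \sum_j (a i j)%:R * r j.
pose r' i : C := s i / D.
have sE i : s i = D * r' i by rewrite /r' mulrC mulfVK.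
have rneg j : m j < 0 -> r j = (k * d)%:R * r' j.
  move=> mj; have : s j = d%:R * r j.
    rewrite /s big1 ?subr0 // => i _; rewrite a0 ?mul0r // negb_and -leNgt.
    by rewrite ltW.
  rewrite sE /D natrM -mulrA => /esym; rewrite [(k * d)%:R * _]mulrCA.
  by move/(mulfI d_neq0).
have arneg i j : (a i j)%:R * r j = (a i j * k * d)%:R * r' j.
  have [mj|mj] := ltP (m j) 0; first by rewrite (rneg _ mj) mulrA -natrM mulnA.
  by rewrite a0 ?mul0n ?mul0r // negb_and -!leNgt mj orbT.
have rE i : d%:R * r i = D * r' i + d%:R * \sum_j (a i j * k)%:R * r' j.
  rewrite -sE /s mulr_sumr -[LHS](subrK (\sum_j (a i j)%:R * r j)); congr (_ + _).
  by apply: eq_bigr => j _; rewrite arneg natrM mulrA [d%:R * _]mulrC.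
exists kappa, r'; split.
- move=> p hp.
  (* A relation [p] among the [r' i] yields [p j * d = \sum_i p i * a i j]. The right side is zero
     when [m j >= 0]; it is then zero when [m j < 0] as well, since it only involves [p i] with
     [m i > 0]. *)
  have hj j : p j *+ d - \sum_i p i * (a i j)%:Z = 0.
    apply: (rind (fun j => p j *+ d - \sum_i p i * (a i j)%:Z)).
    transitivity (D * \sum_i (p i)%:~R * r' i); last by rewrite hp mulr0.
    rewrite mulr_sumr; transitivity (\sum_i (p i)%:~R * s i); last first.
      by apply: eq_bigr => i _; rewrite sE mulrCA.
    rewrite /s; under [RHS]eq_bigr do rewrite mulrBr mulr_sumr.
    rewrite sumrB exchange_big -sumrB; apply: eq_bigr => i _.
    rewrite rmorphB rmorphMn rmorph_sum /= mulrBl mulr_suml -mulr_natl mulrA.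
    congr (_ - _); first by rewrite [d%:R * _]mulrC.
    by apply: eq_bigr => i' _; rewrite rmorphM /= mulrA.
  have pj j : \sum_i p i * (a i j)%:Z = 0 -> p j = 0.
    move=> h; have := hj j; rewrite h subr0 => /eqP.
    by rewrite -mulr_natl mulf_eq0 pnatr_eq0 -[(d == 0)%N]negbK -lt0n d0 => /eqP.
  have ppos j : 0 <= m j -> p j = 0.
    move=> mj; apply: pj; apply: big1 => i _.
    by rewrite a0 ?mulr0 // negb_and -!leNgt mj orbT.
  move=> j; apply: pj; apply: big1 => i _.
  have [mi|mi] := ltP 0 (m i); first by rewrite ppos ?mul0r // ltW.
  by rewrite a0 ?mulr0 // negb_and -!leNgt mi.
- move=> i; have : 0 < Re (s i).
    by rewrite /s ReB Re_sum Re_natM subr_gt0; under eq_bigr do rewrite Re_natM; exact: al.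
  by rewrite sE Re_natM pmulr_rgt0 // ltr0n !muln_gt0 k_gt0 d0.
- move=> i.
  have -> : r i = (k * d)%:R * r' i + \sum_j (a i j * k)%:R * r' j.
    by apply: (mulfI d_neq0); rewrite rE mulrDr; congr (_ + _); rewrite [RHS]mulrA -natrM mulnC.
  apply: ncombD; first exact/ncombM/ncomb_gen.
  by apply: ncomb_sum => j _; exact/ncombM/ncomb_gen.
- have -> : v = \sum_j (m j *+ d + \sum_i m i * (a i j)%:Z)%:~R * r' j.
    have kd : (k * d)%:R != 0 :> C by rewrite pnatr_eq0 muln_eq0 negb_or -!lt0n k_gt0.
    apply: (mulfI kd); rewrite {1}natrM [LHS]mulrAC -[k%:R]/(k%:~R) kv mulrC.
    transitivity (\sum_i (m i)%:~R * (D * r' i + d%:R * \sum_j (a i j * k)%:R * r' j)).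
      by rewrite mulr_sumr; apply: eq_bigr => i _; rewrite -rE mulrCA.
    under eq_bigr do rewrite mulrDr mulrCA.
    rewrite big_split /= [RHS]mulr_sumr.
    under [RHS]eq_bigr do rewrite rmorphD mulrDl mulrDr.
    rewrite big_split /=; congr (_ + _).
      by apply: eq_bigr => i _; rewrite rmorphMn /= -mulr_natl /D !natrM; ring.
    under eq_bigr do rewrite mulr_sumr mulr_sumr.
    rewrite exchange_big; apply: eq_bigr => j _.
    rewrite rmorph_sum mulr_suml mulr_sumr; apply: eq_bigr => i _.
    by rewrite rmorphM /= !natrM; ring.
  apply: ncomb_sum => j _; have := am j; move: (_ + _) => [q|//] _.
  exact/ncombM/ncomb_gen.
Qed.

(** Elements are adjoined one by one; those already covered stay covered because [cone_adjoin] keeps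
    the old generators inside the new monoid. *)
Lemma cone_simplicial (U : seq C) : (forall u, u \in U -> 0 < Re u) ->
  exists (kappa : nat) (r : 'I_kappa -> C),
  [/\ Zlin_indep r, forall i, 0 < Re (r i) & forall u, u \in U -> ncomb _ r u].
Proof.
elim: U => [|v U IH] U0.
  by exists 0%N, (fun=> 0); split => // [m _|] [].
have [u uU|kappa [r [rind r0 rU]]] := IH; first by apply: U0; rewrite inE uU orbT.
have [kappa' [r' [r'ind r'0 rr' vr']]] := cone_adjoin _ _ _ rind r0 (U0 v (mem_head _ _)).
exists kappa', r'; split => // u; rewrite inE => /orP[/eqP -> //|/rU].
exact: ncomb_trans.
Qed.

End Cone.

(** * Monoids generated by a set, and their shifts *)

Section FinitelyGenerated.
Variable R : realType.
Local Notation C := R[i].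
Local Notation Re := (@complex.Re R).
Implicit Types (V W : seq C) (P : set C).

(** Lists of summands allow an infinite [P], such as the set of all exponents, and give induction on
    the number of summands. *)
Definition monoid_span P : set C :=
  [set z | exists2 s : seq C, (forall x, x \in s -> P x) & z = \sum_(x <- s) x].

Lemma monoid_span0 P : monoid_span P 0.
Proof. by exists [::]; rewrite ?big_nil. Qed.

Lemma monoid_spanD P z w : monoid_span P z -> monoid_span P w -> monoid_span P (z + w).
Proof.
move=> [s sP ->] [s' sP' ->]; exists (s ++ s'); last by rewrite big_cat.
by move=> x; rewrite mem_cat => /orP[/sP|/sP'].
Qed.

Lemma monoid_span_gen P z : P z -> monoid_span P z.
Proof.
by move=> Pz; exists [:: z]; [move=> x; rewrite inE => /eqP -> | rewrite big_seq1].
Qed.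

Lemma monoid_span_ind P (Q : C -> Prop) :
  Q 0 -> (forall x z, P x -> monoid_span P z -> Q z -> Q (x + z)) ->
  forall z, monoid_span P z -> Q z.
Proof.
move=> Q0 QD z [s sP ->]; elim: s sP => [|x s IH] sP; first by rewrite big_nil.
have sP' y : y \in s -> P y by move=> ys; apply: sP; rewrite inE ys orbT.
rewrite big_cons; apply: QD; [exact: sP (mem_head _ _) | by exists s | exact: IH].
Qed.

Lemma sub_monoid_span P Q z :
  (forall x, P x -> monoid_span Q x) -> monoid_span P z -> monoid_span Q z.
Proof.
move=> PQ; elim/monoid_span_ind => [|x w /PQ Px _ Qw]; first exact: monoid_span0.
exact: monoid_spanD.
Qed.

Lemma monoid_span_subset V W z :
  {subset V <= W} -> monoid_span [set` V] z -> monoid_span [set` W] z.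
Proof. by move=> VW; apply: sub_monoid_span => x /VW; exact: monoid_span_gen. Qed.

Fixpoint sums_le (V : seq C) (N : nat) : seq C :=
  if N is N'.+1 then 0 :: [seq v + a | v <- V, a <- sums_le V N'] else [:: 0].

Lemma sums_leP V N (s : seq C) : (size s <= N)%N -> {subset s <= V} ->
  \sum_(x <- s) x \in sums_le V N.
Proof.
elim: N s => [|N IH] [|x s] //= sN sV; rewrite ?big_nil ?mem_head //.
rewrite big_cons inE; apply/orP; right; apply: allpairs_f.
  exact: sV (mem_head _ _).
by apply: IH => // y ys; apply: sV; rewrite inE ys orbT.
Qed.

Lemma seq_Re_bound V : (forall v, v \in V -> 0 < Re v) ->
  exists2 rho, 0 < rho & forall v, v \in V -> rho <= Re v.
Proof.
elim: V => [|v V IH] V0; first by exists 1.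
have [w wV|rho rho0 h] := IH; first by apply: V0; rewrite inE wV orbT.
exists (Num.min (Re v) rho); first by rewrite lt_min rho0 V0 ?mem_head.
by move=> w; rewrite inE ge_min => /orP[/eqP ->|/h ->]; rewrite ?lexx ?orbT.
Qed.

(* A long sum still dominates [z] after dropping one summand, so only the
   short sums contribute new generators. *)
Lemma monoid_span_shift V z : (forall v, v \in V -> 0 < Re v) ->
  exists2 W : seq C, (forall w, w \in W -> 0 < Re w) &
    forall a, monoid_span [set` V] a -> Re z < Re a ->
      monoid_span [set` V ++ W] (a - z).
Proof.
move=> V0; have [rho rho0 Vrho] := seq_Re_bound V V0.
(* [N] summands of real part at least [rho] together exceed [Re z], so a sum of more than [N]
   elements can lose one and remain beyond [z]. *)
pose N := (Num.truncn (Re z / rho)).+1.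
have NE : Re z < N%:R * rho by rewrite -ltr_pdivrMr // truncnS_gt.
pose W := [seq a - z | a <- sums_le V N & Re z < Re a].
have WP s : (size s <= N)%N -> {subset s <= V} -> Re z < Re (\sum_(x <- s) x) ->
    monoid_span [set` V ++ W] (\sum_(x <- s) x - z).
  move=> sN sV hz; apply: monoid_span_gen; rewrite /= mem_cat; apply/orP; right.
  by apply: (map_f (fun a => a - z)); rewrite mem_filter hz sums_leP.
exists W.
  by move=> w /mapP[a]; rewrite mem_filter => /andP[az _] ->; rewrite ReB subr_gt0.
move=> _ [s sV ->]; elim: s sV => [|x s IH] sV hz; first exact: WP.
have [sN|sN] := leqP (size (x :: s)) N; first exact: WP.
have sV' y : y \in s -> y \in V by move=> ys; apply: sV; rewrite inE ys orbT.
rewrite big_cons -addrA; apply: monoid_spanD.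
  by apply: monoid_span_gen; rewrite /= mem_cat sV ?mem_head.
apply: IH => //; apply: lt_le_trans NE _.
rewrite Re_sum; have : (size s)%:R * rho <= \sum_(y <- s) Re y.
  elim: (s) sV' => [|y t IHt] tV; first by rewrite big_nil mul0r.
  rewrite big_cons /= -natr1 mulrDl mul1r addrC lerD // ?Vrho ?tV ?mem_head //.
  by apply: IHt => w wt; apply: tV; rewrite inE wt orbT.
apply: le_trans; rewrite ler_pM2r // ler_nat; exact: sN.
Qed.

End FinitelyGenerated.

(** * Finitely supported sums over a whole type *)

Section FiniteSupportSums.
Variables (I : choiceType) (V : zmodType).

(** The sum over [[set: I]] takes the default value [0] when infinitely many terms are nonzero, so
    computing with it requires a finite list [E] covering the support. *)
Lemma fsum_seq (f : I -> V) (E : seq I) : uniq E -> (forall i, f i != 0 -> i \in E) ->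
  \sum_(i \in [set: I]) f i = \sum_(i <- E) f i.
Proof.
move=> uE fE; rewrite (fsbig_seq _ _ uE); apply/esym/fsbig_widen => // i [_ iE].
by apply/eqP/negPn/negP => /fE /iE.
Qed.

Lemma fsum_exchange (J : Type) (r : seq J) (f : I -> J -> V) (E : seq I) :
  uniq E -> (forall i j, f i j != 0 -> i \in E) ->
  \sum_(i \in [set: I]) \sum_(j <- r) f i j = \sum_(j <- r) \sum_(i \in [set: I]) f i j.
Proof.
move=> uE fE; rewrite (fsum_seq _ E) // => [|i].
  by rewrite exchange_big; apply: eq_bigr => j _; rewrite (fsum_seq _ E) // => i; exact: fE.
apply: contraR => iE; rewrite big1 // => j _.
by apply/eqP/negPn/negP => /fE; rewrite (negPf iE).
Qed.

Lemma fsum_neq0 (f : I -> V) : \sum_(i \in [set: I]) f i != 0 -> exists i, f i != 0.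
Proof.
apply: contra_neqP => h; apply: fsbig1 => i _.
by apply/eqP/negPn/negP => fi; apply: h; exists i.
Qed.

Lemma finite_set_uniq_seq (A : set I) : finite_set A ->
  exists2 E : seq I, uniq E & forall i, (i \in E) = (i \in A).
Proof.
move=> /finite_seqP[s ->]; exists (undup s); first exact: undup_uniq.
by move=> i; rewrite mem_undup; apply/idP/idP; rewrite inE.
Qed.

End FiniteSupportSums.

(** * The commutative ring of series with exponents of nonnegative real part *)

Section NonnegSeries.
Variable R : realType.
Local Notation C := R[i].
Local Notation Re := (@complex.Re R).
Local Notation S := (dseries R).

(** The bound is not strict, so that the unit [done] qualifies. Together with [dwf] it makes each
    coefficient of a product a finite sum. *)
Definition wseries (a : S) : Prop := dwf a /\ forall l, a l != 0 -> 0 <= Re l.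

Lemma wseries_seq (a : S) (M : R) : wseries a ->
  exists2 E : seq C, uniq E & forall l, (l \in E) = (a l != 0) && (Re l <= M).
Proof.
move=> [/(_ M) /finite_set_uniq_seq[E uE EP] _]; exists E => // l.
by rewrite EP; apply/idP/andP => [|h]; rewrite inE.
Qed.

Lemma dmul_neq0 (a b : S) m : dmul a b m != 0 -> exists l, a l != 0 /\ b (m - l) != 0.
Proof.
move=> /fsum_neq0[l h]; exists l.
by split; apply: contraNN h => /eqP ->; rewrite ?mul0r ?mulr0.
Qed.

Lemma dmulE (a b : S) m (E : seq C) : (forall l, b l != 0 -> 0 <= Re l) -> uniq E ->
  (forall l, a l != 0 -> Re l <= Re m -> l \in E) ->
  dmul a b m = \sum_(l <- E) a l * b (m - l).
Proof.
move=> b0 uE aE; apply: fsum_seq => // l; rewrite mulf_eq0 negb_or => /andP[al bl].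
by apply: aE => //; have := b0 _ bl; rewrite ReB subr_ge0.
Qed.

Lemma dmulC (a b : S) : dmul a b = dmul b a.
Proof.
apply/funext => m; rewrite /dmul (reindex_fsbigT (fun l => m - l)).
  by apply: eq_fsbigr => l _; rewrite mulrC opprB addrC subrK.
by apply: (@Bijective _ _ _ (fun l => m - l)) => l; rewrite opprB addrC subrK.
Qed.

Lemma dmul1 (a : S) : dmul (@done R) a = a.
Proof.
apply/funext => m; rewrite /dmul (fsum_seq _ _ _ [:: 0]) // => [|l].
  by rewrite big_seq1 /done eqxx mul1r subr0.
by rewrite /done inE; case: ifP => //; rewrite mul0r eqxx.
Qed.

Lemma dmulDl (a b c : S) : wseries a -> wseries b -> wseries c ->
  dmul (a + b : C -> {poly C}) c = dmul a c + dmul b c :> (C -> {poly C}).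
Proof.
move=> wa wb [_ c0]; apply/funext => m.
have [Ea _ EaP] := wseries_seq _ (Re m) wa; have [Eb _ EbP] := wseries_seq _ (Re m) wb.
pose E := undup (Ea ++ Eb); have uE : uniq E := undup_uniq _.
have EE l : (l \in E) = ((a l != 0) || (b l != 0)) && (Re l <= Re m).
  by rewrite mem_undup mem_cat EaP EbP andb_orl.
change (dmul (a + b : C -> {poly C}) c m = dmul a c m + dmul b c m).
rewrite !(dmulE _ _ _ E) // => [|l bl lm|l al lm|l ab lm].
- by rewrite -big_split; apply: eq_bigr => l _; rewrite mulrDl.
- by rewrite EE bl orbT.
- by rewrite EE al.
- rewrite EE lm andbT -negb_and; apply: contraNN ab => /andP[/eqP al /eqP bl].
  by rewrite addrfctE al bl addr0.
Qed.

Lemma wseries_dmul (a b : S) : wseries a -> wseries b -> wseries (dmul a b).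
Proof.
move=> [fa a0] [fb b0]; split=> [M|m /dmul_neq0[l [al bl]]]; last first.
  by have := addr_ge0 (a0 _ al) (b0 _ bl); rewrite -ReD addrC subrK.
apply: sub_finite_set (finite_image2 (fun l k => l + k) (fa M) (fb M)).
move=> m [/dmul_neq0[l [al bl]] mM]; exists l; last first.
  exists (m - l); last by rewrite addrC subrK.
  by split => //; rewrite ReB; apply: le_trans mM; rewrite lerBlDr lerDl a0.
split => //; apply: le_trans mM; have := b0 _ bl.
by rewrite ReB subr_ge0.
Qed.

Lemma dmulA (a b c : S) : wseries a -> wseries b -> wseries c ->
  dmul a (dmul b c) = dmul (dmul a b) c.
Proof.
move=> wa wb wc; apply/funext => m.
have wbc := wseries_dmul _ _ wb wc; have wab := wseries_dmul _ _ wa wb.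
have [Ea uEa EaP] := wseries_seq _ (Re m) wa; have [Eb _ EbP] := wseries_seq _ (Re m) wb.
(* [F] contains every exponent of [dmul a b] up to [Re m]; both sides become one double sum over
   [Ea] and [F]. *)
pose F := undup [seq k + k' | k <- Ea, k' <- Eb]; have uF : uniq F := undup_uniq _.
have FP k l : a k != 0 -> b (l - k) != 0 -> Re l <= Re m -> l \in F.
  move=> ak bl lm; rewrite mem_undup -[l](subrK k) addrC; apply: allpairs_f.
    by rewrite EaP ak; apply: le_trans lm; have := wb.2 _ bl; rewrite ReB subr_ge0.
  by rewrite EbP bl ReB; apply: le_trans lm; rewrite lerBlDr lerDl wa.2.
rewrite (dmulE a _ _ Ea wbc.2 uEa); last by move=> l al lm; rewrite EaP al.
rewrite (dmulE _ c _ F wc.2 uF); last by move=> l /dmul_neq0[k [ak bk]]; exact: (FP k).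
transitivity (\sum_(l <- F) \sum_(k <- Ea) a k * b (l - k) * c (m - l)); last first.
  apply: eq_bigr => l _; rewrite -mulr_suml.
  have [->|cl] := eqVneq (c (m - l)) 0; first by rewrite !mulr0.
  congr (_ * _); apply/esym/dmulE => //; first exact: wb.2.
  move=> k ak kl; rewrite EaP ak; apply: le_trans kl _.
  by have := wc.2 _ cl; rewrite ReB subr_ge0.
rewrite exchange_big; apply: eq_big_seq => k; rewrite EaP => /andP[ak km].
under [RHS]eq_bigr do rewrite -mulrA; rewrite -mulr_sumr; congr (_ * _).
rewrite /dmul (reindex_fsbigT (fun l => l - k)); last first.
  by apply: (@Bijective _ _ _ (fun l => l + k)) => l; rewrite ?subrK ?addrK.
rewrite (fsum_seq _ _ _ F uF) => [|l]; last first.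
  rewrite mulf_eq0 negb_or => /andP[bl cl]; apply: (FP k) => //.
  by have := wc.2 _ cl; rewrite opprB addrA subrK ReB subr_ge0.
by apply: eq_bigr => l _; rewrite opprB addrA subrK.
Qed.

Lemma wseries_done : wseries (@done R).
Proof.
split=> [M|l]; rewrite /done.
  by apply: (sub_finite_set _ (finite_set1 (0 : C))) => l []; case: (eqVneq l 0) => [->|_] //; rewrite eqxx.
by case: (eqVneq l 0) => [->|_] //; rewrite eqxx.
Qed.

Lemma wseries0 : wseries (0 : C -> {poly C}).
Proof.
by split=> [M|l]; rewrite ?eqxx //; apply: sub_finite_set (finite_set0 _) => l []; rewrite eqxx.
Qed.

Lemma wseriesD (a b : S) : wseries a -> wseries b -> wseries (a + b : C -> {poly C}).
Proof.
move=> [fa a0] [fb b0]; have ab l : (a + b : C -> {poly C}) l != 0 -> a l != 0 \/ b l != 0.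
  rewrite addrfctE => h; have [al|] := eqVneq (a l) 0; last by left.
  by right; rewrite al add0r in h.
split=> [M|l /ab[/a0|/b0] //].
apply: (@sub_finite_set _ _ ([set l | a l != 0 /\ Re l <= M] `|` [set l | b l != 0 /\ Re l <= M])).
  by move=> l [/ab[] h lM]; [left|right].
by rewrite finite_setU; split.
Qed.

Lemma wseriesN (a : S) : wseries a -> wseries (- a : C -> {poly C}).
Proof.
move=> [fa a0]; have an l : (- a : C -> {poly C}) l != 0 -> a l != 0 by rewrite opprfctE oppr_eq0.
split=> [M|l /an/a0 //]; apply: sub_finite_set (fa M) => l [/an]; by split.
Qed.

(** Bundling yields a commutative ring, so that [ring] and big products apply to the Taylor
    expansion. The boolean form [[< _ >]] makes this a subtype, whose elements are equal as soon as
    their coefficient maps are. *)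
Record nnseries := NNSeries { nnval :> C -> {poly C}; _ : `[< wseries nnval >] }.
HB.instance Definition _ := [isSub of nnseries for nnval].
HB.instance Definition _ := [Choice of nnseries by <:].

Lemma nnseriesP (a : nnseries) : wseries a.
Proof. by case: a => a ha; apply/asboolP. Qed.

Definition mk_nn (a : S) (wa : wseries a) : nnseries := NNSeries _ (asboolT wa).

Definition nn_zero := mk_nn _ wseries0.
Definition nn_one := mk_nn _ wseries_done.
Definition nn_add (a b : nnseries) := mk_nn _ (wseriesD _ _ (nnseriesP a) (nnseriesP b)).
Definition nn_opp (a : nnseries) := mk_nn _ (wseriesN _ (nnseriesP a)).
Definition nn_mul (a b : nnseries) := mk_nn _ (wseries_dmul _ _ (nnseriesP a) (nnseriesP b)).

Fact nn_addA : associative nn_add.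
Proof. by move=> a b c; apply/val_inj/addrA. Qed.
Fact nn_addC : commutative nn_add.
Proof. by move=> a b; apply/val_inj/addrC. Qed.
Fact nn_add0 : left_id nn_zero nn_add.
Proof. by move=> a; apply/val_inj/add0r. Qed.
Fact nn_addN : left_inverse nn_zero nn_opp nn_add.
Proof. by move=> a; apply/val_inj/addNr. Qed.
HB.instance Definition _ := GRing.isZmodule.Build nnseries nn_addA nn_addC nn_add0 nn_addN.

Fact nn_mulA : associative nn_mul.
Proof. by move=> a b c; apply/val_inj/dmulA; exact: nnseriesP. Qed.
Fact nn_mulC : commutative nn_mul.
Proof. by move=> a b; apply/val_inj/dmulC. Qed.
Fact nn_mul1 : left_id nn_one nn_mul.
Proof. by move=> a; apply/val_inj/dmul1. Qed.
Fact nn_mulDl : left_distributive nn_mul nn_add.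
Proof. by move=> a b c; apply/val_inj/dmulDl; exact: nnseriesP. Qed.
Fact nn_one_neq0 : nn_one != nn_zero.
Proof.
apply/eqP => /(congr1 (fun a : nnseries => a 0)); rewrite /= /done eqxx => /eqP.
by rewrite oner_eq0.
Qed.
HB.instance Definition _ :=
  GRing.Zmodule_isComNzRing.Build nnseries nn_mulA nn_mulC nn_mul1 nn_mulDl nn_one_neq0.

Implicit Types (a b : nnseries) (L : R) (l m : C).

Lemma nn0E l : (0 : nnseries) l = 0. Proof. by []. Qed.
Lemma nnDE a b l : (a + b) l = a l + b l. Proof. by []. Qed.
Lemma nnNE a l : (- a) l = - a l. Proof. by []. Qed.
Lemma nnBE a b l : (a - b) l = a l - b l. Proof. by []. Qed.
Lemma nnME a b : a * b = dmul a b :> (C -> {poly C}). Proof. by []. Qed.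

Lemma nn_sumE (I : Type) (s : seq I) (P : pred I) (f : I -> nnseries) l :
  (\sum_(i <- s | P i) f i) l = \sum_(i <- s | P i) f i l.
Proof. by apply: (big_morph (fun a : nnseries => a l)) => [a b|]; rewrite ?nnDE ?nn0E. Qed.

Lemma nn_natME (k : nat) a l : (k%:R * a) l = k%:R * a l.
Proof.
rewrite mulr_natl mulr_natl; elim: k => [|k IH]; first by rewrite !mulr0n.
by rewrite !mulrS nnDE IH.
Qed.

Definition supp_in (P : set C) a : Prop := forall l, a l != 0 -> P l.

Lemma supp_in1 (P : set C) : P 0 -> supp_in P 1.
Proof. by move=> P0 l; rewrite /= /done; case: (eqVneq l 0) => [->|_] //; rewrite eqxx. Qed.

Lemma supp_in0 (P : set C) : supp_in P 0.
Proof. by move=> l; rewrite nn0E eqxx. Qed.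

Lemma supp_inD (P : set C) a b : supp_in P a -> supp_in P b -> supp_in P (a + b).
Proof.
move=> Pa Pb l; rewrite nnDE; have [al|/Pa//] := eqVneq (a l) 0.
by rewrite al add0r => /Pb.
Qed.

Lemma supp_inN (P : set C) a : supp_in P a -> supp_in P (- a).
Proof. by move=> Pa l; rewrite nnNE oppr_eq0 => /Pa. Qed.

Lemma supp_inB (P : set C) a b : supp_in P a -> supp_in P b -> supp_in P (a - b).
Proof. by move=> Pa Pb; apply: supp_inD => //; exact: supp_inN. Qed.

Lemma supp_inM (P Q T : set C) a b : (forall l k, P l -> Q k -> T (l + k)) ->
  supp_in P a -> supp_in Q b -> supp_in T (a * b).
Proof.
move=> PQT Pa Qb m /dmul_neq0[l [/Pa Pl /Qb Ql]].
by have := PQT _ _ Pl Ql; rewrite addrC subrK.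
Qed.

Lemma supp_in_sum (P : set C) (I : Type) (s : seq I) (Q : pred I) (f : I -> nnseries) :
  (forall i, Q i -> supp_in P (f i)) -> supp_in P (\sum_(i <- s | Q i) f i).
Proof.
by move=> h; elim/big_rec: _ => [|i x Qi hx]; [exact: supp_in0 | apply: supp_inD => //; exact: h].
Qed.

(** A filtration by ideals whose orders add under multiplication; [nn_ge (L + L)] will mean
    negligible to second order. *)
Definition nn_ge L : nnseries -> Prop := supp_in [set l | L <= Re l].

Lemma nn_ge0 a : nn_ge 0 a.
Proof. exact: (nnseriesP a).2. Qed.

Lemma nn_geM L L' a b : nn_ge L a -> nn_ge L' b -> nn_ge (L + L') (a * b).
Proof. by apply: supp_inM => l k /= lL kL'; rewrite ReD lerD. Qed.

Lemma nn_geMl L a b : nn_ge L b -> nn_ge L (a * b).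
Proof. by move=> bL; rewrite -[L]add0r; apply: nn_geM => //; exact: nn_ge0. Qed.

Lemma nn_geMr L a b : nn_ge L a -> nn_ge L (a * b).
Proof. by rewrite mulrC; exact: nn_geMl. Qed.

Definition nmono (k : nat) (t : 'I_k -> nnseries) (al : {ffun 'I_k -> nat}) : nnseries :=
  \prod_i t i ^+ al i.

Lemma dmonoE (k : nat) (s : 'I_k -> S) (t : 'I_k -> nnseries) al :
  (forall i, s i = t i) -> dmono s al = nmono _ t al.
Proof.
move=> st; rewrite /dmono /nmono -big_enum; elim: (enum _) => [|i r IH] /=.
  by rewrite big_nil.
rewrite big_cons nnME IH; congr dmul.
rewrite /dexp st; elim: (al i) => [//|p IHp].
by rewrite exprS nnME -IHp.
Qed.

Lemma nn_geX L a (k : nat) : nn_ge L a -> nn_ge (L *+ k) (a ^+ k).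
Proof.
move=> aL; elim: k => [|k IH]; first exact: nn_ge0.
by rewrite exprS mulrS; exact: nn_geM.
Qed.

Lemma nmono_ge L (k : nat) (t : 'I_k -> nnseries) al :
  (forall i, nn_ge L (t i)) -> nn_ge (L *+ mdeg al) (nmono _ t al).
Proof.
move=> tL; rewrite /nmono /mdeg -sumrMnr.
apply: (big_rec2 (fun x y => nn_ge x y)) => [|i x y _ xy]; first exact: nn_ge0.
by apply: nn_geM => //; exact: nn_geX.
Qed.

Lemma nmono_supp (P : set C) (k : nat) (t : 'I_k -> nnseries) al :
  P 0 -> (forall l l', P l -> P l' -> P (l + l')) ->
  (forall i, supp_in P (t i)) -> supp_in P (nmono _ t al).
Proof.
move=> P0 PD Pt; apply: (big_ind (supp_in P)) => [|a b Pa Pb|i _]; first exact: supp_in1.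
  exact: supp_inM PD Pa Pb.
elim: (al i) => [|p IH]; first exact: supp_in1.
by rewrite exprS; exact: supp_inM PD (Pt i) IH.
Qed.

(** From [k] to [k.+1] the remainder [e] becomes [a * e - b * e] minus a multiple of [b * b], all of
    order [L + L]. *)
Lemma nn_taylorX L a b (k : nat) : 0 <= L -> nn_ge L b ->
  nn_ge (L + L) (a ^+ k - (a - b) ^+ k - k%:R * a ^+ k.-1 * b).
Proof.
move=> L0 bL; elim: k => [|k IH]; first by rewrite !expr0 subrr !mul0r subrr; exact: supp_in0.
pose e := a ^+ k - (a - b) ^+ k - k%:R * a ^+ k.-1 * b.
have -> : a ^+ k.+1 - (a - b) ^+ k.+1 - k.+1%:R * a ^+ k * b =
    a * e - b * e - k%:R * a ^+ k.-1 * (b * b).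
  rewrite /e !exprS; case: k {IH e} => [|k]; first by rewrite !expr0; ring.
  by rewrite -!natr1 /= !exprS; ring.
apply: supp_inB; last by apply: nn_geMl; exact: nn_geM.
by apply: supp_inB; exact: nn_geMl.
Qed.

(** Leibniz rule modulo order [L + L]. Besides multiples of earlier remainders, each induction step
    creates only the cross term [d i * T], a product of two factors of order [L]. *)
Lemma nn_taylor_prod L (I : eqType) (r : seq I) (x y d : I -> nnseries) :
  0 <= L -> uniq r -> (forall i, nn_ge L (d i)) ->
  (forall i, nn_ge (L + L) (x i - y i - d i)) ->
  nn_ge (L + L) (\prod_(i <- r) x i - \prod_(i <- r) y i
                 - \sum_(i <- r) d i * \prod_(j <- r | j != i) x j).
Proof.
move=> L0 + dL xyd; elim: r => [|i r IH] /=; first by rewrite !big_nil subrr subr0 => _; exact: supp_in0.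
move=> /andP[ir ur]; rewrite !big_cons eqxx /=.
have -> : \prod_(j <- r | j != i) x j = \prod_(j <- r) x j.
  rewrite big_seq_cond [RHS]big_seq_cond; apply: eq_bigl => j.
  by case: eqP => [->|_]; rewrite ?(negPf ir) // andbT.
have -> : \sum_(j <- r) d j * \prod_(k <- i :: r | k != j) x k =
    x i * \sum_(j <- r) d j * \prod_(k <- r | k != j) x k.
  rewrite mulr_sumr big_seq [RHS]big_seq; apply: eq_bigr => j jr.
  by rewrite big_cons; case: eqP ir => [->|_ _]; rewrite ?jr // mulrCA.
set X := \prod_(j <- r) x j; set Y := \prod_(j <- r) y j in IH *.
set T := \sum_(j <- r) _ in IH *.
have TL : nn_ge L T by apply: supp_in_sum => j _; apply: nn_geMr.
have -> : x i * X - y i * Y - (d i * X + x i * T) =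
    (x i - y i - d i) * Y + x i * (X - Y - T) - (d i * (X - Y - T) + d i * T) by ring.
have {}IH := IH ur.
apply: supp_inB; first by apply: supp_inD; [exact: nn_geMr | exact: nn_geMl].
by apply: supp_inD; [exact: nn_geMl | exact: nn_geM].
Qed.

(** Exponent of the monomial after differentiation in variable [i]. Truncated subtraction leaves
    [al] unchanged if [al i = 0], where the factor [al i] in front vanishes. *)
Definition mpred (k : nat) (al : {ffun 'I_k -> nat}) (i : 'I_k) : {ffun 'I_k -> nat} :=
  [ffun j => (al j - (j == i))%N].

Lemma nmono_taylor L (k : nat) (t b : 'I_k -> nnseries) al :
  0 <= L -> (forall i, nn_ge L (b i)) ->
  nn_ge (L + L) (nmono _ t al - nmono _ (fun i => t i - b i) al
                 - \sum_i (al i)%:R * (nmono _ t (mpred _ al i) * b i)).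
Proof.
move=> L0 bL.
have -> : \sum_i (al i)%:R * (nmono _ t (mpred _ al i) * b i) =
    \sum_i ((al i)%:R * t i ^+ (al i).-1 * b i) * \prod_(j | j != i) t j ^+ al j.
  apply: eq_bigr => i _; rewrite /nmono (bigD1 i) //= ffunE eqxx subn1.
  rewrite (eq_bigr (fun j => t j ^+ al j)); first by rewrite !mulrA mulrAC.
  by move=> j /negPf ji; rewrite ffunE ji subn0.
apply: nn_taylor_prod => // [|i|i]; first exact: index_enum_uniq.
  exact: nn_geMl.
exact: nn_taylorX.
Qed.

End NonnegSeries.

(** * First-order expansion of a substituted power series *)

Section Linearization.
Variable R : realType.
Local Notation C := R[i].
Local Notation Re := (@complex.Re R).
Local Notation S := (dseries R).

Lemma mdeg_le_seq (k N : nat) :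
  exists2 A : seq {ffun 'I_k -> nat}, uniq A & forall al, (mdeg al <= N)%N -> al \in A.
Proof.
pose A := [seq [ffun i => nat_of_ord (f i)] | f : {ffun 'I_k -> 'I_N.+1}].
exists (undup A); first exact: undup_uniq.
move=> al alN; rewrite mem_undup; apply/mapP.
exists [ffun i => inord (al i)]; first by rewrite mem_enum.
apply/ffunP => i; rewrite !ffunE inordK // ltnS; apply: leq_trans alN.
by rewrite /mdeg (bigD1 i) //= leq_addr.
Qed.

Lemma mdeg_mpred (k : nat) (al : {ffun 'I_k -> nat}) i : (mdeg al <= (mdeg (mpred _ al i)).+1)%N.
Proof.
rewrite /mdeg (bigD1 i) //= [X in (_ <= X.+1)%N](bigD1 i) //= ffunE eqxx -addSn.
apply: leq_add; first by case: (al i) => // p; rewrite subn1.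
by apply: leq_sum => j /negPf ji; rewrite ffunE ji subn0.
Qed.

Lemma dsubstE (k : nat) Fc (s : 'I_k -> S) (t : 'I_k -> nnseries R) mu :
  (forall i, s i = t i) ->
  dsubst Fc s mu = \sum_(al \in [set: {ffun 'I_k -> nat}]) Fc al *: nmono _ _ t al mu.
Proof. by move=> st; apply: eq_fsbigr => al _; rewrite (dmonoE _ _ _ t). Qed.

(** At [tau] the quadratic remainder vanishes since [Re tau < L + L], and the constant part vanishes
    by the assumption on monomials in [t i - b i]. The linear part is the chain rule, with products
    expanded over the exponents of [b i]. *)
Lemma dsubst_linear (k : nat) Fc (s : 'I_k -> S) (t b : 'I_k -> nnseries R)
    (rho L : R) (tau : C) (E : seq C) :
  (forall i, s i = t i) -> 0 < rho -> (forall i, nn_ge _ rho (t i)) ->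
  0 <= L -> (forall i, nn_ge _ L (b i)) -> Re tau < L + L ->
  (forall al, nmono _ _ (fun i => t i - b i) al tau = 0) ->
  uniq E -> (forall i l, b i l != 0 -> Re l <= Re tau -> l \in E) ->
  dsubst Fc s tau = \sum_i \sum_(l <- E) b i l * dsubst (pderiv_coef Fc i) s (tau - l).
Proof.
move=> st rho0 trho L0 bL tauL tb0 uE bE; rewrite (dsubstE _ _ _ t) //.
(* Every factor has real part at least [rho], so a monomial of degree above [N] has no exponent up
   to [Re tau]. *)
pose N := Num.truncn (Re tau / rho).
have NP al mu : Re mu <= Re tau -> nmono _ _ t al mu != 0 -> (mdeg al <= N)%N.
  move=> mutau /(nmono_ge _ _ _ _ al trho) /= h.
  have h' := le_trans h mutau; rewrite truncn_ge_nat.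
    by rewrite ler_pdivlMr // mulr_natl.
  by apply: divr_ge0 (ltW rho0); apply: le_trans h'; rewrite mulrn_wge0 // ltW.
(* The extra one is there because [mpred] lowers the degree by at most one. *)
have [A uA AP] := mdeg_le_seq k N.+1.
pose G i (al : {ffun 'I_k -> nat}) : {poly C} :=
  Fc al *: ((al i)%:R * (nmono _ _ t (mpred _ al i) * b i) tau).
have GA al i : G i al != 0 -> al \in A.
  rewrite /G => h; apply: AP; apply: leq_trans (mdeg_mpred _ al i) _; rewrite ltnS.
  have : (nmono _ _ t (mpred _ al i) * b i) tau != 0.
    by apply: contraNN h => /eqP ->; rewrite mulr0 scaler0.
  move=> /dmul_neq0[l [tl bl]]; apply: NP tl.
  by have := nn_ge0 _ (b i) _ bl; rewrite /= ReB subr_ge0.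
transitivity (\sum_(al \in [set: {ffun 'I_k -> nat}]) \sum_i G i al).
  apply: eq_fsbigr => al _; rewrite -scaler_sumr; congr (_ *: _).
  have := nmono_taylor _ L _ t b al L0 bL tau.
  rewrite !nnBE tb0 subr0 nn_sumE; under eq_bigr do rewrite nn_natME.
  set X := _ - _; have [X0 _|_ /(_ isT)] := eqVneq X 0; first exact: (subr0_eq X0).
  by rewrite /= leNgt tauL.
rewrite (fsum_exchange _ _ _ _ _ _ uA GA); apply: eq_bigr => i _.
(* This reindexing turns [al i * Fc al] into a coefficient of the [i]-th partial derivative; indices
   outside the range of [msucc] have [al i = 0] and contribute nothing. *)
pose msucc (al : {ffun 'I_k -> nat}) : {ffun 'I_k -> nat} := [ffun j => al j + (j == i)]%N.
have msuccK al : mpred _ (msucc al) i = al.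
  by apply/ffunP => j; rewrite !ffunE addnK.
transitivity (\sum_(al \in range msucc) G i al).
  apply/esym/fsbig_widen => // al [_ /= hal].
  have [ali|ali] := eqVneq (al i) 0%N; first by rewrite /G ali mul0r scaler0.
  case: hal; exists (mpred _ al i) => //; apply/ffunP => j; rewrite !ffunE.
  by case: (eqVneq j i) => [->|_]; rewrite ?subn0 ?addn0 // subnK // lt0n.
rewrite (reindex_fsbig msucc [set: _]); last first.
  by apply: inj_bij => al al' _ _ e; rewrite -(msuccK al) e msuccK.
transitivity (\sum_(al \in [set: {ffun 'I_k -> nat}])
    \sum_(l <- E) pderiv_coef Fc i al *: (b i l * nmono _ _ t al (tau - l))).
  apply: eq_fsbigr => al _; rewrite /G msuccK -scaler_sumr nnME dmulC.
  rewrite (dmulE _ _ _ _ E) //; [|exact: nn_ge0|exact: bE].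
  rewrite /pderiv_coef mulr_natl -scaler_nat scalerA [_ * Fc _]mulrC.
  by rewrite /msucc ffunE eqxx addn1.
rewrite (fsum_exchange _ _ _ _ _ A uA); last first.
  move=> al l h; apply: AP; apply: leqW; have bl : b i l != 0.
    by apply: contraNN h => /eqP ->; rewrite mul0r scaler0.
  apply: (NP _ (tau - l)); first by rewrite ReB gerBl; exact: nn_ge0 bl.
  by apply: contraNN h => /eqP ->; rewrite mulr0 scaler0.
apply: eq_bigr => l _; rewrite (dsubstE _ _ _ t) // mulr_fsumr.
by apply: eq_fsbigr => al _; rewrite scalerAr.
Qed.

End Linearization.

(** * The characteristic polynomial [\sum_j A j * z ^ j] *)

Section Symbol.
Variable R : realType.
Local Notation C := R[i].
Local Notation Re := (@complex.Re R).

Lemma ddelta_supp (a : dseries R) j l : iter j (@ddelta R) a l != 0 -> a l != 0.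
Proof.
apply: contraNN => /eqP al; apply/eqP; elim: j => [//|j IH].
by rewrite iterS /ddelta IH scaler0 linear0 addr0.
Qed.

(** On the coefficient of [x ^ l], [ddelta] acts as [l + d/dt]. Differentiation lowers the degree in
    [t], so in degree [d] only multiplication by [l] is seen. *)
Lemma ddelta_lead (a : dseries R) j l d : (size (a l) <= d.+1)%N ->
  (size (iter j (@ddelta R) a l) <= d.+1)%N /\
  (iter j (@ddelta R) a l)`_d = l ^+ j * (a l)`_d.
Proof.
move=> ad; elim: j => [|j [IHs IHc]]; first by rewrite expr0 mul1r.
rewrite iterS /ddelta; split.
  apply/leq_sizeP => i di; rewrite coefD coefZ coef_deriv.
  by rewrite !nth_default ?mulr0 ?mul0rn ?addr0 // (leq_trans IHs) // leqW.
by rewrite coefD coefZ coef_deriv IHc [_`_d.+1]nth_default // mul0rn addr0 exprS mulrA.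
Qed.

(** With [d] the exact degree of [a l], the coefficient of [t ^ d] is the characteristic polynomial
    at [l] times a nonzero leading coefficient. *)
Lemma symbol_root (a : dseries R) (n : nat) (A : 'I_n -> C) l : a l != 0 ->
  \sum_(j < n) iter j (@ddelta R) a l * (A j)%:P = 0 -> \sum_j A j * l ^+ j = 0.
Proof.
move=> al; have [d sd] : exists d, size (a l) = d.+1.
  by case: (size (a l)) (size_poly_gt0 (a l)) => [|d]; rewrite al // => _; exists d.
move=> /(congr1 (fun p : {poly C} => p`_d)); rewrite coef_sum coef0 => h.
have ad : (a l)`_d != 0 by have := lead_coef_eq0 (a l); rewrite /lead_coef sd (negPf al) => ->.
apply: (mulIf ad); rewrite mul0r -[RHS]h mulr_suml; apply: eq_bigr => j _.
by rewrite coefMC (ddelta_lead _ _ _ d _).2 ?sd //; ring.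
Qed.

Lemma root_Re_bound (p : {poly C}) : p != 0 -> exists M : R, forall z, root p z -> Re z <= M.
Proof.
move: {2}(size p) (leqnn (size p)) => N; elim: N p => [|N IH] p pN p0.
  by rewrite size_poly_leq0 (negPf p0) in pN.
have [[z pz]|nroot] := pselect (exists z, root p z); last by exists 0 => z pz; case: nroot; exists z.
have [q pE] := factor_theorem _ _ pz; have q0 : q != 0 by apply: contraNneq p0 => q0; rewrite pE q0 mul0r.
have [|M qM] := IH q _ q0; first by move: pN; rewrite pE size_Mmonic ?monicXsubC // size_XsubC addn2.
exists (Num.max M (Re z)) => w; rewrite pE rootM root_XsubC le_max => /orP[/qM ->//|/eqP ->].
by rewrite lexx orbT.
Qed.

Lemma symbol_Re_bound (n : nat) (A : 'I_n -> C) j : A j != 0 ->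
  exists M : R, forall z, \sum_i A i * z ^+ i = 0 -> Re z <= M.
Proof.
move=> Aj; pose p : {poly C} := \sum_i A i *: 'X^i.
have pE : p`_j = A j.
  rewrite coef_sum (bigD1 j) //= coefZ coefXn eqxx mulr1 big1 ?addr0 // => i ij.
  by rewrite coefZ coefXn eq_sym (inj_eq val_inj) (negPf ij) mulr0.
have [|M pM] := root_Re_bound p; first by apply: contraNneq Aj => p0; rewrite -pE p0 coef0.
exists M => z hz; apply: pM; rewrite /root horner_sum -[X in _ == X]hz; apply/eqP.
by apply: eq_bigr => i _; rewrite hornerZ hornerXn.
Qed.

End Symbol.

(** * Induction over exponents, and heads and tails of series *)

Section Exponents.
Variable R : realType.
Local Notation C := R[i].
Local Notation Re := (@complex.Re R).
Local Notation S := (dseries R).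

Lemma wseries_sub (P : set C) (a : S) :
  (forall M : R, finite_set (P `&` [set l | Re l <= M])) -> (forall l, P l -> 0 <= Re l) ->
  (forall l, a l != 0 -> P l) -> wseries _ a.
Proof.
move=> fP P0 aP; split=> [M|l /aP/P0 //].
by apply: sub_finite_set (fP M) => l [/aP].
Qed.

(** Only finitely many exponents have real part at most [Re l0], so the number of those with real
    part below [Re l] is a decreasing measure. *)
Lemma wseries_ind (a : S) (Q : C -> Prop) : wseries _ a ->
  (forall l, a l != 0 -> (forall l', a l' != 0 -> Re l' < Re l -> Q l') -> Q l) ->
  forall l, a l != 0 -> Q l.
Proof.
move=> wa QI l0 al0; have [E uE EP] := wseries_seq _ _ (Re l0) wa.
suff h N l : (size [seq l' <- E | (Re l' < Re l)%R] < N)%N -> l \in E -> Q l.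
  by apply: (h _ _ (leqnn _)); rewrite EP al0 lexx.
elim: N l => [//|N IH] l lN lE; have := lE; rewrite EP => /andP[al ll0].
apply: QI => // l' al' l'l; have l'E : l' \in E by rewrite EP al' (le_trans (ltW l'l)).
apply: IH => //; rewrite ltnS in lN; apply: leq_trans lN.
apply: (@uniq_leq_size _ (l' :: [seq k <- E | Re k < Re l'])).
  by rewrite /= filter_uniq // mem_filter ltxx.
move=> k; rewrite inE !mem_filter => /orP[/eqP ->|/andP[kl' ->]]; first by rewrite l'l.
by rewrite (lt_trans kl').
Qed.

Lemma monoid_span_Re_ge0 (P : set C) z :
  (forall l, P l -> 0 <= Re l) -> monoid_span _ P z -> 0 <= Re z.
Proof.
by move=> P0; elim/monoid_span_ind => [//|x w /P0 px _ wx]; rewrite ReD addr_ge0.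
Qed.

Lemma monoid_span_Re_le (P : set C) z : (forall l, P l -> 0 <= Re l) ->
  monoid_span _ P z -> monoid_span _ (P `&` [set l | Re l <= Re z]) z.
Proof.
move=> P0 [s sP ->]; exists s => // x xs; split; first exact: sP.
rewrite /= Re_sum (big_rem x) //= lerDl big_seq; apply: sumr_ge0 => y /mem_rem ys.
exact/P0/sP.
Qed.

Fact wseries_tail (L : R) (a : nnseries R) : wseries _ (fun l => if L <= Re l then a l else 0).
Proof.
apply: (wseries_sub [set l | a l != 0]) => [M|l|l]; last by case: ifP => //; rewrite eqxx.
  exact: (nnseriesP _ a).1.
exact: (nnseriesP _ a).2.
Qed.

(** The tail serves as the increment [b] of [dsubst_linear]; the head is [a - nn_tail L a]. *)
Definition nn_tail (L : R) (a : nnseries R) : nnseries R := mk_nn _ _ (wseries_tail L a).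

Lemma nn_tail_ge (L : R) (a : nnseries R) : nn_ge _ L (nn_tail L a).
Proof. by move=> l /=; case: ifP => //; rewrite eqxx. Qed.

Lemma nn_head_supp (L : R) (a : nnseries R) l :
  (a - nn_tail L a) l != 0 -> a l != 0 /\ Re l < L.
Proof.
by rewrite nnBE /=; case: leP => _; rewrite ?subrr ?eqxx // subr0.
Qed.

Lemma dargs_supp (n : nat) (phi : S) i l : dargs n phi i l != 0 -> l = 1 \/ phi l != 0.
Proof.
rewrite /dargs; case: unliftP => [j _ /ddelta_supp|_]; first by right.
by rewrite /dX; case: (eqVneq l 1) => [->|_]; [left | rewrite eqxx].
Qed.

Lemma ncomb_gen_semigroup (kappa : nat) (r : 'I_kappa -> C) z :
  ncomb _ _ r z -> z != 0 -> gen_semigroup r z.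
Proof.
move=> [m zE] z0; exists m; split => //.
apply: contrapT => h; case/eqP: z0; rewrite zE big1 // => i _.
have [->|mi] := eqVneq (m i) 0%N; first by rewrite mul0r.
by case: h; exists i.
Qed.

End Exponents.

(** * Descent on the exponents of [phi] and construction of the semigroup *)

Theorem theorem2 (R : realType) (n : nat) (Fc : {ffun 'I_n.+2 -> nat} -> R[i])
    (phi : dseries R) :
  (1 <= n)%N ->
  conv_pseries Fc ->
  (exists al, Fc al != 0) ->
  Fc [ffun => 0%N] = 0 ->
  dulac phi ->
  (* phi is a formal solution of F(x, y, delta y, ..., delta^n y) = 0 *)
  dsubst Fc (dargs n phi) = @dzero R ->
  (* F'_{y_n}(x, phi, ..., delta^n phi) is not identically zero *)
  dsubst (pderiv_coef Fc (lift ord0 ord_max)) (dargs n phi) != @dzero R ->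
  (* the asymptotic form of F'_{y_j}(x, phi, ..., delta^n phi) *)
  (exists (nu : R[i]) (A : 'I_n.+1 -> R[i]),
      (exists j, A j != 0) /\
      forall j : 'I_n.+1,
        let D := dsubst (pderiv_coef Fc (lift ord0 j)) (dargs n phi) in
        exists nuj : R[i],
          [/\ complex.Re nu < complex.Re nuj,
              D nu = (A j)%:P,
              D nuj != 0 &
              forall sigma, sigma != nu -> D sigma != 0 ->
                complex.Re nuj <= complex.Re sigma]) ->
  exists (kappa : nat) (r : 'I_kappa -> R[i]),
    [/\ Zlin_indep r,
        (forall i, 0 < complex.Re (r i)),
        gen_semigroup r 1 &
        (forall l, phi l != 0 -> gen_semigroup r l)].
Proof.
move=> _ _ _ _ [fphi [l1 phil1] phi0] Fphi _ [nu [A [[j0 Aj0] Aas]]].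
pose P : set R[i] := [set l | l = 1 \/ phi l != 0].
have P0 l : P l -> 0 < complex.Re l by case=> [->|/phi0 //]; rewrite ltr01.
have wphi : wseries _ phi by split=> // l /phi0/ltW.
have ws i : wseries _ (dargs n phi i).
  apply: (wseries_sub _ P) => [M|l /P0/ltW //|l]; last exact: dargs_supp.
  apply: (@sub_finite_set _ _ ([set 1] `|` [set l | phi l != 0 /\ complex.Re l <= M])).
    by move=> l [[->|phil] lM]; [left|right].
  by rewrite finite_setU; split; [exact: finite_set1 | exact: fphi].
pose t i := mk_nn _ _ (ws i).
have st i : dargs n phi i = t i by [].
have tP i l : t i l != 0 -> P l by exact: dargs_supp.
have [rho rho0 trho] : exists2 rho, 0 < rho & forall i, nn_ge _ rho (t i).
  have [E1 _ E1P] := wseries_seq _ _ 1 wphi.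
  (* Including [1] in the list forces [rho <= 1], so only the finitely many exponents of real part
     at most [1] need comparison with [rho]. *)
  have [v|rho rho0 E1rho] := seq_Re_bound _ (1 :: E1).
    by rewrite inE => /orP[/eqP ->|]; rewrite ?ltr01 // E1P => /andP[/phi0].
  exists rho => // i l /tP /= Pl; have [lrho|lrho] := leP rho (complex.Re l) => //.
  have rho1 : rho <= 1 by have := E1rho 1 (mem_head _ _).
  have : rho <= complex.Re l; last by rewrite leNgt lrho.
  apply: E1rho; rewrite inE; case: Pl => [->|phil]; first by rewrite eqxx.
  by rewrite E1P phil (ltW (lt_le_trans lrho rho1)) orbT.
(* Since [A j0 != 0], some monomial in the arguments of [F] has a nonzero coefficient at
   [x ^ nu]. *)
have nuP : monoid_span _ P nu.
  have [nuj [_ Dnu _ _]] := Aas j0.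
  have : dsubst (pderiv_coef Fc (lift ord0 j0)) (dargs n phi) nu != 0.
    by rewrite Dnu polyC_eq0.
  rewrite (dsubstE _ _ _ _ t) // => /fsum_neq0[al].
  rewrite scaler_eq0 negb_or => /andP[_].
  apply: (nmono_supp _ (monoid_span _ P)).
  - exact: monoid_span0.
  - by move=> l l'; exact: monoid_spanD.
  - by move=> i l /tP; exact: monoid_span_gen.
have nu0 : 0 <= complex.Re nu by apply: monoid_span_Re_ge0 nuP => l /P0/ltW.
have [M0 symM0] := symbol_Re_bound _ _ _ _ Aj0.
(* Beyond [M]: the variable [x] has no tail, as [M >= 1]; [Re (nu + l) < 2 * Re l], as [M >= Re nu];
   and the characteristic polynomial has no root, as [M >= M0]. *)
pose M := Num.max 1 (Num.max (complex.Re nu) M0).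
have M1 : 1 <= M by rewrite le_max lexx.
have Mnu : complex.Re nu <= M by rewrite !le_max lexx orbT.
have MM0 : M0 <= M by rewrite !le_max lexx !orbT.
have [E0 _ E0P] := wseries_seq _ _ M wphi.
pose V := 1 :: E0.
have VP l : P l -> complex.Re l <= M -> l \in V.
  by rewrite inE E0P => -[->|->] lM; rewrite ?eqxx // lM orbT.
have V0 v : v \in V -> 0 < complex.Re v.
  by rewrite inE E0P => /orP[/eqP ->|/andP[/phi0]]; rewrite ?ltr01.
have nuV : monoid_span _ [set` V] nu.
  have := monoid_span_Re_le _ _ _ (fun l Pl => ltW (P0 l Pl)) nuP.
  apply: sub_monoid_span => l [Pl /= lnu]; apply: monoid_span_gen.
  by apply: VP => //; exact: le_trans Mnu.
(* [W1] will treat sums with exactly one exponent beyond [M], from which one [nu] is subtracted;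
   [W2] those with none, from which [nu + nu] is. *)
have [W1 W10 W1P] := monoid_span_shift _ V nu V0.
have [W2 W20 W2P] := monoid_span_shift _ V (nu + nu) V0.
pose U := V ++ W1 ++ W2.
have U0 u : u \in U -> 0 < complex.Re u.
  by rewrite !mem_cat => /or3P[/V0|/W10|/W20].
have VU z : monoid_span _ [set` V] z -> monoid_span _ [set` U] z.
  by apply: monoid_span_subset => x; rewrite mem_cat => ->.
have key l : phi l != 0 -> M < complex.Re l -> monoid_span _ [set` U] (l - nu).
  move: l; apply: (wseries_ind _ _ _ wphi) => l phil IH lM.
  pose L := complex.Re l; pose tau := nu + l.
  pose b i := nn_tail _ L (t i).
  have bL i : nn_ge _ L (b i) by exact: nn_tail_ge.
  have tauL : complex.Re tau < L + L by rewrite ReD ltrD2r (le_lt_trans Mnu).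
  have L0 : 0 <= L by rewrite ltW // phi0.
  have ltau : complex.Re l <= complex.Re tau by rewrite ReD lerDr.
  (* Either a monomial in the head reaches [tau], which makes [tau] a sum of smaller exponents, or
     the linear equation at [tau] makes [l] a root of the characteristic polynomial, which is
     excluded. *)
  have [[al tbal]|nob] := pselect (exists al, nmono _ _ (fun i => t i - b i) al tau != 0); last first.
    have [E uE EP] := wseries_seq _ _ (complex.Re tau) wphi.
    have b0 l' : b ord0 l' = 0.
      rewrite /b /= /dargs unlift_none /dX; case: (eqVneq l' 1) => [->|_]; last by case: ifP.
      by rewrite leNgt (le_lt_trans M1 lM).
    have bE i l' : b i l' != 0 -> complex.Re l' <= complex.Re tau -> l' \in E.
      case: (unliftP ord0 i) => [j ->|->]; last by rewrite b0 eqxx.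
      rewrite /b /= /dargs liftK EP => bl' ->; rewrite andbT.
      by move: bl'; case: ifP => _; [exact: ddelta_supp | rewrite eqxx].
    have := dsubst_linear _ _ Fc _ _ b rho L tau E st rho0 trho L0 bL tauL.
    move=> /(_ _ uE bE) H; have {}H : \sum_i \sum_(l' <- E) b i l' *
        dsubst (pderiv_coef Fc i) (dargs n phi) (tau - l') = 0.
      rewrite -H ?Fphi // => al; apply/eqP/negPn/negP => h; apply: nob; by exists al.
    suff : complex.Re l <= M0 by rewrite leNgt (le_lt_trans MM0 lM).
    apply: symM0; apply: (symbol_root _ phi) => //; rewrite -[RHS]H [RHS]big_ord_recl.
    rewrite [X in _ = X + _]big1 ?add0r => [|l' _]; last by rewrite b0 mul0r.
    apply: eq_bigr => j _; have [nuj [nunuj Dnu _ Dnuj]] := Aas j.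
    have lE : l \in E by rewrite EP phil.
    (* The term [l' = l] gives [A j]. For another [l'] in the tail,
       [Re (tau - l') <= Re nu < Re nuj] and [tau - l' != nu], so the coefficient of the derivative
       is zero. *)
    rewrite (bigD1_seq l) //= big1_seq ?addr0 => [|l' /andP[l'l _]].
      by rewrite /tau addrK Dnu /dargs liftK lexx.
    case: ifP => [Ll'|_]; last by rewrite mul0r.
    suff -> : dsubst (pderiv_coef Fc (lift ord0 j)) (dargs n phi) (tau - l') = 0.
      by rewrite mulr0.
    apply/eqP/negPn/negP => /Dnuj h.
    have : complex.Re nuj <= complex.Re (tau - l').
      apply: h; apply: contraNneq l'l => e; apply/eqP/(addrI nu).
      by rewrite -/tau -e subrK.
    by rewrite leNgt (le_lt_trans _ nunuj) // ReB ReD lerBlDr lerD2l.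
  pose Q : set R[i] := [set x | P x /\ complex.Re x < L].
  have tauQ : monoid_span _ Q tau.
    move: tbal; apply: (nmono_supp _ (monoid_span _ Q)).
    - exact: monoid_span0.
    - by move=> x y; exact: monoid_spanD.
    - by move=> i x /nn_head_supp[/tP Px xL]; apply: monoid_span_gen.
  (* A sum with at most one exponent beyond [M] stays explicit; two such
     exponents each absorb one copy of [nu]. *)
  have split3 z : monoid_span _ Q z ->
      [\/ monoid_span _ [set` V] z,
          exists a l', [/\ monoid_span _ [set` V] a, phi l' != 0, M < complex.Re l',
                           complex.Re l' < L & z = a + l'] |
          monoid_span _ [set` U] (z - (nu + nu))].
    elim/monoid_span_ind => [|x {}z [Px xL] _ IHz]; first by apply: Or31; exact: monoid_span0.
    have [xM|xM] := leP (complex.Re x) M.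
      have xV : monoid_span _ [set` V] x by apply: monoid_span_gen; exact: VP.
      case: IHz => [zV|[a [l' [aV phil' l'M l'L ->]]]|zU].
      - by apply: Or31; exact: monoid_spanD.
      - apply: Or32; exists (x + a), l'; split => //; last by rewrite addrA.
        exact: monoid_spanD.
      - by apply: Or33; rewrite -addrA; apply: monoid_spanD => //; exact: VU.
    have phix : phi x != 0 by case: Px => // x1; move: xM; rewrite x1 ltNge M1.
    have xU := IH _ phix xL xM.
    case: IHz => [zV|[a [l' [aV phil' l'M l'L ->]]]|zU].
    - by apply: Or32; exists z, x; split => //; rewrite addrC.
    - apply: Or33; have -> : x + (a + l') - (nu + nu) = a + ((x - nu) + (l' - nu)) by ring.
      by apply: monoid_spanD; [exact: VU | apply: monoid_spanD => //; exact: IH].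
    - apply: Or33; have -> : x + z - (nu + nu) = nu + (x - nu) + (z - (nu + nu)) by ring.
      by do 2?[apply: monoid_spanD => //]; exact: VU.
  (* Hence the third case of [split3] is already the goal. *)
  have tauE : tau - (nu + nu) = l - nu by rewrite /tau; ring.
  case: (split3 _ tauQ) => [tauV|[a [l' [aV phil' l'M l'L taua]]]|]; last by rewrite tauE.
  - rewrite -tauE; have : complex.Re (nu + nu) < complex.Re tau.
      by rewrite !ReD ltrD2l (le_lt_trans Mnu).
    move=> /(W2P _ tauV); apply: monoid_span_subset => x; rewrite !mem_cat.
    by case/orP => ->; rewrite ?orbT.
  - have -> : l - nu = (a - nu) + (l' - nu).
      have -> : a = tau - l' by rewrite taua addrK.
      by rewrite /tau; ring.
    apply: monoid_spanD; last exact: IH.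
    (* Here [a = nu + l - l'] with [Re l' < Re l], so the shift by [nu] is covered by [W1]. *)
    have : complex.Re nu < complex.Re a.
      have -> : a = tau - l' by rewrite taua addrK.
      by rewrite ReB ReD ltrBrDr ltrD2l.
    move=> /(W1P _ aV); apply: monoid_span_subset => x; rewrite !mem_cat.
    by case/orP => ->; rewrite ?orbT.
have [kappa [r [rind r0 rU]]] := cone_simplicial _ U U0.
(* Positive real part excludes [0], the one element of the monoid that the semigroup lacks. *)
have spanG z : monoid_span _ [set` U] z -> 0 < complex.Re z -> gen_semigroup r z.
  move=> zU z0; apply: ncomb_gen_semigroup; last first.
    by apply: contraTneq z0 => ->; rewrite ltxx.
  elim/monoid_span_ind: zU => [|x y /rU rx _ ry]; first exact: ncomb0.
  exact: ncombD.
exists kappa, r; split => // [|l phil].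
  apply: spanG; last exact: ltr01.
  by apply/VU/monoid_span_gen; rewrite /= mem_head.
apply: spanG; last exact: phi0.
have [lM|lM] := leP (complex.Re l) M.
  by apply/VU/monoid_span_gen; apply: VP => //; right.
(* A large exponent is [(l - nu) + nu], and both parts lie in the monoid generated by [U]. *)
by rewrite -[l](subrK nu); apply: monoid_spanD; [exact: key | exact: VU].
Qed.
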